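(* Let $p\in\mathbb{C}[z]$ be a polynomial of degree $n$ with roots $\lambda_1,\ldots,\lambda_n$, and let $\mu_1,\ldots,\mu_{n-1}$ be the roots of its derivative $p'$ (roots listed with multiplicity). Suppose $\sum_{j=1}^n\lambda_j=0$. Then $$n\sum_{j=1}^{n-1}|\mu_j|^2\le(n-2)\sum_{j=1}^n|\lambda_j|^2,$$ and equality holds if and only if all the numbers $\lambda_j$ lie on the same (real straight) line in $\mathbb{C}$. *)

(* Defs.v *)
From mathcomp Require Import all_boot all_order all_algebra.
From mathcomp Require Import reals complex.

Set Implicit Arguments.
Unset Strict Implicit.
Unset Printing Implicit Defensive.

Import Order.TTheory GRing.Theory Num.Theory.

Local Open Scope ring_scope.
Local Open Scope complex_scope.

(* Same shape as [closed_field_poly_normal]. It is only meaningful for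
   [p != 0], since any [s] satisfies it when [p = 0]. *)
Definition roots_with_multiplicity (F : fieldType) (p : {poly F}) (s : seq F) :
    Prop :=
  p = lead_coef p *: \prod_(z <- s) ('X - z%:P).

Definition on_common_real_line (R : realType) (s : seq R[i]) : Prop :=
  exists a b : R[i],
    b != 0 /\ forall z, z \in s -> exists t : R, z = a + t%:C * b.

(* Main.v *)
(** Let [D = diag(lambda)] and let [P] be the orthogonal projection onto the
    hyperplane orthogonal to [(1, ..., 1)]. The eigenvalues of the compression
    [B = P D P] are the critical points [mu] together with one extra [0]: since
    [P P = P], [char_poly B = char_poly (D P)], and [D P] is a rank one
    perturbation of [D]. Schur's inequality bounds the sum of the [|mu_j|^2] by
    the squared Frobenius norm of [B], which is [(1 - 2/n)] times the sum of the
    [|lambda_j|^2] because the [lambda_j] sum to [0]. Equality holds iff [B] is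
    normal; as [n (B^* B - B B^* )] has entries
    [lambda_i lambda_j^* - lambda_i^* lambda_j], this says that all products
    [lambda_i lambda_j^*] are real. *)

Require Import Defs.
From mathcomp Require Import all_boot all_order all_algebra.
From mathcomp Require Import reals complex.
From mathcomp Require Import ring.

Set Implicit Arguments.
Unset Strict Implicit.
Unset Printing Implicit Defensive.

Import Order.TTheory GRing.Theory Num.Theory.

Local Open Scope ring_scope.

(** * Derivatives of products, determinants and characteristic polynomials *)

Lemma deriv_prod (R : comNzRingType) (I : finType) (F : I -> {poly R}) :
  (\prod_i F i)^`() = \sum_i (F i)^`() * \prod_(j | j != i) F j.
Proof.
(* Uniqueness is carried along so that [j != i] drops exactly one factor. *)
elim: (index_enum I) (index_enum_uniq I) => [|i r IHr] /=.
  by rewrite !big_nil derivC.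
case/andP=> i_notin_r uniq_r; rewrite !big_cons eqxx /= derivM IHr //.
congr (_ * _ + _).
  rewrite [LHS]big_seq [RHS]big_seq_cond; apply: eq_bigl => j.
  by case: (boolP (j \in r)) => //= j_in_r; rewrite (memPn i_notin_r).
rewrite mulr_sumr; apply: eq_big_seq => j j_in_r.
by rewrite big_cons eq_sym (memPn i_notin_r) // mulrCA.
Qed.

(* Both sides of the identity are [\det A] times the determinant of
   [block_mx A u (- v) 1]. *)
Lemma det_rank1_update (R : comNzRingType) n (A : 'M[R]_n) (u w : 'cV_n)
    (v : 'rV_n) :
  A *m w = \det A *: u ->
  \det A * \det (A + u *m v) = \det A * (\det A + (v *m w) 0 0).
Proof.
move=> Aw.
set M := block_mx A u (- v) 1%:M.
have detM : \det M = \det (A + u *m v).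
  have -> : \det M = \det (M *m block_mx 1%:M 0 v 1%:M).
    by rewrite det_mulmx det_lblock !det1 !mulr1.
  rewrite mulmx_block !mulmx1 !mulmx0 mul1mx !add0r addNr.
  by rewrite det_ublock det1 mulr1.
rewrite -detM mulrC.
(* [w] acts as adj(A) u: by [Aw], multiplying [M] by this block matrix clears the upper right
   block. *)
have -> : \det A = \det (block_mx 1%:M (- w) 0 (\det A)%:M : 'M_(n + 1)).
  by rewrite det_ublock det1 mul1r det_scalar1.
rewrite -det_mulmx mulmx_block !mulmx1 !mulmx0 mulmxN Aw !addr0.
rewrite mul_mx_scalar addNr det_lblock mulNmx mulmxN opprK mul1mx.
by rewrite det_ublock det1 mul1r det_scalar1 (mx11_scalar (_ + _)) det_scalar1
  !mxE eqxx addrC.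
Qed.

(** One block determinant is computed by two eliminations, through its identity block and through
    its scalar block ['X]. The second costs a factor ['X^n], which is monic and so can be
    cancelled. *)
Lemma char_poly_mulmxC (R : idomainType) n (A B : 'M[R]_n) :
  char_poly (A *m B) = char_poly (B *m A).
Proof.
pose A' := map_mx polyC A; pose B' := map_mx polyC B.
set M := block_mx ('X%:M) A' B' 1%:M.
have detM : \det M = char_poly (A *m B).
  have -> : \det M = \det (M *m block_mx 1%:M 0 (- B') 1%:M).
    by rewrite det_mulmx det_lblock !det1 !mulr1.
  rewrite mulmx_block !mulmx1 !mulmx0 mul1mx !add0r mulmxN addrN.
  by rewrite det_ublock det1 mulr1 -map_mxM.
have detMX : \det M * 'X^n = 'X^n * char_poly (B *m A).
  have -> : \det M * 'X^n = \det (M *m block_mx 1%:M (- A') 0 'X%:M).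
    by rewrite det_mulmx det_ublock det1 mul1r det_scalar.
  rewrite mulmx_block !mulmx1 !mulmx0 !addr0 !mulmxN mul1mx.
  by rewrite scalar_mxC addNr det_lblock det_scalar addrC -map_mxM.
by apply: (mulIf (monic_neq0 (monicXn R n))); rewrite -detM detMX mulrC.
Qed.

(** * Frobenius norm and Schur's inequality *)

Lemma adjmx_mul (C : numClosedFieldType) m n p (A : 'M[C]_(m, n))
    (B : 'M_(n, p)) : ((A *m B)^t* = B^t* *m A^t*)%sesqui.
Proof. by rewrite trmx_mul map_mxM. Qed.

Lemma mxtrace_mul_adjmx (C : numClosedFieldType) m n (A : 'M[C]_(m, n)) :
  \tr (A *m A^t*)%sesqui = \sum_i \sum_j `|A i j| ^+ 2.
Proof.
apply: eq_bigr => i _; rewrite mxE; apply: eq_bigr => j _.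
by rewrite !mxE normCK.
Qed.

Section SchurInequality.

Local Open Scope sesquilinear_scope.

Variables (C : numClosedFieldType) (n : nat) (A : 'M[C]_n) (s : seq C).
Hypothesis char_polyA : char_poly A = \prod_(z <- s) ('X - z%:P).

(** [T] is similar to [A], and a triangular matrix has its eigenvalues on the diagonal. *)
Lemma sum_norm_eigenvalues_trig (U : 'M[C]_n) (T := U *m A *m U^t*) :
  U \is unitarymx -> is_trig_mx T ->
  \sum_(z <- s) `|z| ^+ 2 = \sum_i `|T i i| ^+ 2.
Proof.
move=> /unitarymxP/mulmx1C U_unitary T_trig.
have : char_poly T = char_poly A.
  by rewrite char_poly_mulmxC mulmxA U_unitary mul1mx.
rewrite char_polyA char_poly_trig // -(big_map (fun i => T i i) xpredT
  (fun z => 'X - z%:P)) => /prod_XsubC_eq /(perm_big _) /esym ->.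
by rewrite big_map.
Qed.

Lemma mxtrace_mul_adjmx_unitary (U : 'M[C]_n) (T := U *m A *m U^t*) :
  U \is unitarymx -> \tr (A *m A^t*) = \sum_i \sum_j `|T i j| ^+ 2.
Proof.
move=> U_unitary; rewrite -mxtrace_mul_adjmx /T !adjmx_mul trmxCK !mulmxA.
rewrite mulmxKtV // [RHS]mxtrace_mulC !mulmxA.
by have /unitarymxP/mulmx1C -> := U_unitary; rewrite mul1mx.
Qed.

Lemma unitary_trig :
  exists2 U : 'M[C]_n, U \is unitarymx & is_trig_mx (U *m A *m U^t*).
Proof.
(* [Schur] asks for a positive size, so the empty matrix is treated apart. *)
case: n A => [|m] B; last first.
  by have [U U_unitary] := Schur B (ltn0Sn m); exists U; rewrite // -conjymx.
exists 1%:M; last by apply/is_trig_mxP => -[].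
by apply/unitarymxP; rewrite [LHS]flatmx0 [RHS]flatmx0.
Qed.

(** In a unitary triangular form, the entries off the diagonal only add to the Frobenius norm. *)
Lemma schur_inequality : \sum_(z <- s) `|z| ^+ 2 <= \tr (A *m A^t*).
Proof.
have [U U_unitary T_trig] := unitary_trig.
rewrite (sum_norm_eigenvalues_trig U_unitary) //.
rewrite (mxtrace_mul_adjmx_unitary U_unitary).
apply: ler_sum => i _; rewrite (bigD1 i) //= lerDl sumr_ge0 // => j _.
by rewrite exprn_ge0.
Qed.

(** Equality forces the triangular form to be diagonal, so [A] is unitarily diagonalisable, hence
    normal; the converse is the spectral theorem. *)
Lemma schur_equality :
  \sum_(z <- s) `|z| ^+ 2 = \tr (A *m A^t*) <-> A \is normalmx.
Proof.
split=> [|/orthomx_spectralP A_spec]; last first.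
  have U_unitary := spectral_unitarymx A; set U := spectralmx A in A_spec *.
  have T_diag : is_diag_mx (U *m A *m U^t*).
    have := unitarymx_unit U_unitary; rewrite -invmx_unitary // => U_unit.
    by rewrite A_spec !mulmxA mulmxV // mul1mx mulmxK // diag_mx_is_diag.
  rewrite (sum_norm_eigenvalues_trig U_unitary) ?is_diag_mx_is_trig //.
  rewrite (mxtrace_mul_adjmx_unitary U_unitary); apply: eq_bigr => i _.
  rewrite (bigD1 i) //= big1 ?addr0 // => j; rewrite eq_sym => ij.
  by rewrite (is_diag_mxP T_diag) // normr0 expr0n.
have [U U_unitary T_trig] := unitary_trig.
rewrite (sum_norm_eigenvalues_trig U_unitary) //.
rewrite (mxtrace_mul_adjmx_unitary U_unitary).
set T := U *m A *m U^t* in T_trig *.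
have nneg i j : 0 <= `|T i j| ^+ 2 by rewrite exprn_ge0.
(* The difference of the two sides is a sum over rows of nonnegative off-diagonal contributions, so
   each of them vanishes. *)
move=> /eqP; rewrite eq_sym -subr_eq0 -sumrB => /eqP T0.
have /diag_mxP[e Te] : is_diag_mx T.
  apply/is_diag_mxP => i j ij.
  have rowE k : \sum_l `|T k l| ^+ 2 - `|T k k| ^+ 2 =
      \sum_(l | l != k) `|T k l| ^+ 2.
    by rewrite (bigD1 k) //= addrAC subrr add0r.
  have row0 : \sum_(l | l != i) `|T i l| ^+ 2 = 0.
    rewrite -rowE; apply: (psumr_eq0P _ T0) => // k _.
    by rewrite rowE sumr_ge0.
  have := psumr_eq0P (fun l _ => nneg i l) row0 (i := j).
  by rewrite eq_sym => /(_ ij)/eqP; rewrite expf_eq0 normr_eq0 => /eqP.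
apply/orthomx_spectral_subproof; exists (U, e) => //=.
rewrite -Te invmx_unitary // /T !mulmxA mulmxKtV //.
by have /unitarymxP/mulmx1C -> := U_unitary; rewrite mul1mx.
Qed.

End SchurInequality.

(** * Compression of a diagonal matrix to the mean-zero hyperplane *)

Section Projection.

Local Open Scope sesquilinear_scope.

Variables (C : numClosedFieldType) (n : nat) (d : 'rV[C]_n).
Hypothesis n_gt0 : (0 < n)%N.

Definition mean_zero_proj : 'M[C]_n := 1%:M - n%:R^-1 *: const_mx 1.
Local Notation P := mean_zero_proj.
Local Notation D := (diag_mx d).

Definition compression : 'M[C]_n := P *m D *m P.

Let n_neq0 : n%:R != 0 :> C.
Proof. by rewrite pnatr_eq0 -lt0n. Qed.

Lemma mul_mean_zero_proj m (A : 'M[C]_(m, n)) i j :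
  (A *m P) i j = A i j - n%:R^-1 * \sum_k A i k.
Proof.
rewrite mulmxBr mulmx1 -scalemxAr !mxE; congr (_ - _ * _).
by apply: eq_bigr => k _; rewrite mxE mulr1.
Qed.

Lemma tr_mean_zero_proj : P^T = P.
Proof. by rewrite linearB linearZ /= trmx1 trmx_const. Qed.

Lemma mean_zero_projK : P *m P = P.
Proof.
apply/matrixP=> i j; rewrite mul_mean_zero_proj.
suff -> : \sum_k P i k = 0 by rewrite mulr0 subr0.
under eq_bigr => k _ do rewrite !mxE mulr1.
rewrite sumrB (bigD1 i) //= eqxx big1 ?addr0; last first.
  by move=> k /negPf; rewrite eq_sym => ->.
by rewrite sumr_const card_ord -[_ *+ n]mulr_natr mulVf ?subrr.
Qed.

Lemma char_poly_compression :
  n%:R *: char_poly compression = 'X * (\prod_i ('X - (d 0 i)%:P))^`().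
Proof.
rewrite /compression -mulmxA char_poly_mulmxC -mulmxA mean_zero_projK.
set q := \prod_i _; pose q_ i := \prod_(j | j != i) ('X - (d 0 j)%:P).
have qE i : q = ('X - (d 0 i)%:P) * q_ i by rewrite /q (bigD1 i).
have q_neq0 : q != 0 by apply/monic_neq0/monic_prod_XsubC.
pose A := diag_mx (\row_i ('X - (d 0 i)%:P)).
pose u := \col_i (n%:R^-1 * d 0 i)%:P.
have detA : \det A = q by rewrite det_diag; apply: eq_bigr => i _; rewrite mxE.
have -> : char_poly (D *m P) = \det (A + u *m const_mx 1).
  have -> : D *m P = \matrix_(i, j) (d 0 i *+ (i == j) - n%:R^-1 * d 0 i).
    apply/matrixP=> i j; rewrite mul_diag_mx !mxE.
    by rewrite mulr1 mulrBr mulr_natr (mulrC (d 0 i)).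
  congr (\det _); apply/matrixP=> i j; rewrite !mxE big_ord1 !mxE mulr1.
  by rewrite !rmorphB /= rmorphMn /= mulrnBl opprB addrA [RHS]addrAC.
(* The vector given for [w] is adj(A) u, since [q_ i] is the cofactor of the i-th diagonal entry of
   [A]. *)
have := @det_rank1_update _ _ A u (\col_i ((n%:R^-1 * d 0 i)%:P * q_ i))
                          (const_mx 1).
rewrite detA => /(_ _)/(mulfI q_neq0) ->.
  (* Each index contributes [q + d_i q_i = 'X * q_i], because [q = ('X - d_i) * q_i]; summing gives
     ['X] times the derivative of [q]. *)
  rewrite deriv_prod mulr_sumr scalerDr !mxE scaler_sumr.
  have -> : n%:R *: q = \sum_(i < n) q.
    by rewrite sumr_const card_ord scaler_nat.
  rewrite -big_split /=; apply: eq_bigr => i _.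
  rewrite !mxE {1}(qE i) derivXsubC.
  rewrite -mul_polyC !mul1r polyCM !mulrA -polyCM mulfV //.
  by rewrite polyC1 mul1r mulrBl; apply: subrK.
apply/colP=> i; rewrite mul_diag_mx !mxE.
by rewrite mulrCA -qE mulrC.
Qed.

Lemma adj_mean_zero_proj : P^t* = P.
Proof.
apply/matrixP=> i j; rewrite !mxE rmorphB rmorphM fmorphV !rmorph1 !rmorph_nat.
by rewrite eq_sym.
Qed.

Lemma mul_mean_zero_projl m (A : 'M[C]_(n, m)) i j :
  (P *m A) i j = A i j - n%:R^-1 * \sum_k A k j.
Proof.
have -> : (P *m A) i j = (A^T *m P) j i.
  by rewrite -{2}tr_mean_zero_proj -trmx_mul [RHS]mxE.
by rewrite mul_mean_zero_proj mxE; under eq_bigr => k _ do rewrite mxE.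
Qed.

(** Serves to write both B B^* and B^* B as compressions of a single matrix. *)
Lemma mul_compress (X Y : 'M[C]_n) :
  P *m X *m P *m (P *m Y *m P) = P *m (X *m P *m Y) *m P.
Proof. by rewrite !mulmxA -(mulmxA _ P P) mean_zero_projK. Qed.

Lemma diag_mean_zero_projE (a b : 'rV[C]_n) i j :
  (diag_mx a *m P *m diag_mx b) i j =
  a 0 i * b 0 j *+ (i == j) - n%:R^-1 * (a 0 i * b 0 j).
Proof.
by rewrite mul_mx_diag mxE mul_diag_mx !mxE mulr1 mulrBr mulr_natr mulrBl
  mulrnAl mulrCA -!mulrA.
Qed.

Lemma adj_compression : compression^t* = P *m diag_mx (map_mx Num.conj d) *m P.
Proof.
rewrite /compression !adjmx_mul adj_mean_zero_proj tr_diag_mx map_diag_mx.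
by rewrite mulmxA.
Qed.

Hypothesis sum_d : \sum_i d 0 i = 0.

Let sum_conj_d : \sum_i (d 0 i)^* = 0.
Proof. by rewrite -rmorph_sum sum_d rmorph0. Qed.

(** By cyclicity the trace is that of P X with X = D P D^*. As the [d_i] sum to 0, column i of X
    sums to |d_i|^2, while n X_ii = (n - 1) |d_i|^2; hence the factor n - 2. *)
Lemma mxtrace_compression :
  n%:R * \tr (compression *m compression^t*) =
  (n%:R - 2) * \sum_i `|d 0 i| ^+ 2.
Proof.
rewrite adj_compression /compression mul_compress mxtrace_mulC (mulmxA P P).
rewrite mean_zero_projK /mxtrace mulr_sumr mulr_sumr.
under eq_bigr => i _.
  rewrite mul_mean_zero_projl mulrBr (mulVKf n_neq0) diag_mean_zero_projE.
  rewrite eqxx mulr1n mulrBr (mulVKf n_neq0).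
  under eq_bigr => k _ do rewrite diag_mean_zero_projE mulrA.
  rewrite sumrB -mulr_suml -mulr_sumr sum_d mulr0 mul0r subr0.
  rewrite (bigD1 i) //= eqxx mulr1n big1 ?addr0; last first.
    by move=> k /negPf ->.
  rewrite !mxE -normCK.
  over.
by apply: eq_bigr => i _ /=; ring.
Qed.

Lemma normal_compression :
  compression \is normalmx <-> forall i j, d 0 i * (d 0 j)^* \is Num.real.
Proof.
set dc := map_mx Num.conj d.
pose K := D *m P *m diag_mx dc - diag_mx dc *m P *m D.
have KE i j : K i j = n%:R^-1 * ((d 0 i)^* * d 0 j - d 0 i * (d 0 j)^*).
  rewrite /K mxE [X in _ + X]mxE !diag_mean_zero_projE !mxE.
  case: eqP => [->|_]; first by rewrite !mulr1n; ring.
  by rewrite !mulr0n; ring.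
(* The rows and columns of [K] sum to 0, so compressing leaves [K] unchanged and [K] is itself the
   commutator of B and B^*. *)
have PKP : P *m K *m P = K.
  apply/matrixP=> i j; rewrite mul_mean_zero_proj.
  have PK k l : (P *m K) k l = K k l.
    rewrite mul_mean_zero_projl; under eq_bigr => m _ do rewrite KE.
    rewrite -mulr_sumr sumrB -!mulr_suml sum_d sum_conj_d.
    by rewrite !mul0r subrr !mulr0 subr0.
  under eq_bigr => l _ do rewrite PK KE.
  rewrite PK -mulr_sumr sumrB -!mulr_sumr sum_d sum_conj_d.
  by rewrite !mulr0 subrr !mulr0 subr0.
have KP : compression *m compression^t* - compression^t* *m compression = K.
  rewrite -PKP adj_compression /compression -/dc !mul_compress.
  by rewrite -(mulmxBl _ _ P) -(mulmxBr P).
have K0 : (compression \is normalmx) = (K == 0).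
  by rewrite -KP subr_eq0 qualifE.
rewrite K0; split=> [/eqP K_eq0 i j|real_d].
  have /eqP := congr1 (fun M : 'M_n => M i j) K_eq0.
  rewrite KE mxE mulf_eq0 invr_eq0 (negPf n_neq0) subr_eq0 => /eqP dd.
  by apply/CrealP; rewrite rmorphM /= conjCK.
apply/eqP/matrixP => i j; rewrite KE mxE.
have /CrealP := real_d i j; rewrite rmorphM /= conjCK => ->.
by rewrite subrr mulr0.
Qed.

End Projection.

(** * Collinearity of points with centroid 0 *)

Local Open Scope complex_scope.

(** A line containing all the points contains their centroid 0, so the points are real multiples of
    one [b] and the products are real multiples of |b|^2. Conversely, any nonzero point serves as
    direction. *)
Lemma on_common_real_lineP (R : realType) n (d : 'I_n -> R[i]) :
  \sum_i d i = 0 ->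
  on_common_real_line (codom d) <-> forall i j, d i * (d j)^*%R \is Num.real.
Proof.
move=> sum_d; split=> [[a [b [_ line]]] i j|real_d].
  have {line} line k : exists t : R, d k = a + t%:C * b.
    by apply: line; apply: codom_f.
  have n_neq0 : n%:R != 0 :> R.
    by rewrite pnatr_eq0 -lt0n (leq_ltn_trans _ (ltn_ord i)).
  have [t dt] : exists t : 'I_n -> R, forall k, d k = a + (t k)%:C * b.
    exact: (@fin_all_exists _ (fun=> R) (fun k x => d k = a + x%:C * b) line).
  (* [m] is the parameter of the centroid: averaging [dt] over all indices gives a + m b = 0. *)
  pose m := n%:R^-1 * \sum_k t k.
  have a_def : a = - m%:C * b.
    have : n%:R * a + (\sum_k t k)%:C * b = 0.
      rewrite -[RHS]sum_d; under [RHS]eq_bigr => k _ do rewrite dt.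
      rewrite big_split /= sumr_const card_ord mulr_natl -mulr_suml.
      by rewrite rmorph_sum.
    have nC : n%:R != 0 :> R[i].
      by rewrite -(rmorph_nat (real_complex R)) fmorph_eq0.
    move=> /eqP; rewrite addr_eq0 => /eqP na; apply: (mulfI nC); rewrite na /m.
    by rewrite rmorphM fmorphV rmorph_nat !mulNr mulrN !mulrA mulfV // mul1r.
  have dE k : d k = (t k - m)%:C * b by rewrite dt a_def rmorphB /=; ring.
  have real_C (x : R) : x%:C \is Num.real by apply/CrealP; apply: conjc_real.
  rewrite !dE rmorphM /= (CrealP (real_C _)) mulrACA -normCK.
  by rewrite !rpredM ?rpredX ?normr_real.
have [/existsP[k dk]|d0] := boolP [exists k, d k != 0]; last first.
  (* All points are 0, so any direction will do. *)
  exists 0, 1; split=> [|_ /codomP[i ->]]; first exact: oner_neq0.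
  exists 0; rewrite add0r mul0r; apply/eqP; apply: contraR d0 => di.
  by apply/existsP; exists i.
exists 0, (d k); split=> // _ /codomP[i ->].
exists (complex.Re (d i / d k)); rewrite add0r RRe_real ?divfK //.
by rewrite invC_norm mulrCA rpredM // rpredV rpredX // normr_real.
Qed.

(** * From matrices back to roots and critical points *)

Theorem theorem4p10 (R : realType) (n : nat) (p : {poly R[i]})
    (lambda : n.-tuple R[i]) (mu : n.-1.-tuple R[i])
    (n_gt0 : (0 < n)%N)
    (deg_p : size p = n.+1)
    (roots_p : roots_with_multiplicity p lambda)
    (roots_dp : roots_with_multiplicity p^`() mu)
    (sum_lambda : \sum_(z <- lambda) z = 0) :
  (n%:R * (\sum_(w <- mu) `|w| ^+ 2) <=
     (n%:R - 2) * (\sum_(z <- lambda) `|z| ^+ 2))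
  /\
  (n%:R * (\sum_(w <- mu) `|w| ^+ 2) =
     (n%:R - 2) * (\sum_(z <- lambda) `|z| ^+ 2)
   <-> on_common_real_line lambda).
Proof.
pose d : 'rV[R[i]]_n := \row_i tnth lambda i.
have sum_dE (F : R[i] -> R[i]) : \sum_(z <- lambda) F z = \sum_i F (d 0 i).
  by rewrite big_tuple; apply: eq_bigr => i _; rewrite mxE.
have sum_d : \sum_i d 0 i = 0 by rewrite -(sum_dE id).
pose q := \prod_i ('X - (d 0 i)%:P); pose r := \prod_(w <- mu) ('X - w%:P).
have n_pos : 0 < n%:R :> R[i] by rewrite ltr0n.
have p_neq0 : lead_coef p != 0 by rewrite lead_coef_eq0 -size_poly_eq0 deg_p.
have pE : p = lead_coef p *: q.
  rewrite {1}roots_p; congr (_ *: _); rewrite big_tuple.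
  by apply: eq_bigr => i _; rewrite mxE.
pose c := lead_coef p^`() / lead_coef p.
have dq : q^`() = c *: r.
  by apply: (scalerI p_neq0); rewrite -derivZ -pE scalerA mulrC divfK.
have monic_r : r \is monic by apply: monic_prod_XsubC.
have char_poly_B : char_poly (compression d) =
    \prod_(z <- 0 :: val mu) ('X - z%:P).
  rewrite big_cons subr0 -/r; apply: (scalerI (lt0r_neq0 n_pos)).
  rewrite char_poly_compression // -/q dq -scalerAr; congr (_ *: _).
  (* Comparing leading coefficients in [char_poly_compression] gives [c] = n. *)
  have := congr1 lead_coef (char_poly_compression d n_gt0).
  rewrite -/q dq -scalerAr !lead_coefZ (monicP (char_poly_monic _)).
  by rewrite ['X * r]mulrC lead_coefMX (monicP monic_r) !mulr1 => ->.
have sum_mu : \sum_(z <- 0 :: val mu) `|z| ^+ 2 = \sum_(w <- mu) `|w| ^+ 2.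
  by rewrite big_cons normr0 expr0n add0r.
(* Both sides now carry the positive factor n; removing it leaves Schur's inequality and its
   equality case for the compression. *)
rewrite sum_dE -mxtrace_compression // -sum_mu; split.
  by rewrite ler_pM2l // schur_inequality.
have -> : tval lambda = codom (d 0).
  by rewrite -[LHS]map_tnth_enum; apply: eq_map => i; rewrite mxE.
have line := on_common_real_lineP sum_d.
have normal := normal_compression n_gt0 sum_d.
have [schur_l schur_r] := schur_equality char_poly_B.
split=> [/(mulfI (lt0r_neq0 n_pos))/schur_l/normal/line|] //.
by move=> /line/normal/schur_r ->.
Qed.
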